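(* Let $A$ be an analytic function in $\mathbb{D}$, and let $f_1,f_2\in\mathcal{B}$ be linearly independent solutions of the differential equation $f''+Af=0$ such that $\inf_{z\in\mathbb{D}}\big(|f_1(z)|+|f_2(z)|\big)>0$. Then $$\sup_{z\in\mathbb{D}}|A(z)|(1-|z|^2)^2<\infty,$$ and the spherical derivative $(f_1/f_2)^{\#}$ is bounded in $\mathbb{D}$.
   Context: $\mathbb{D}=\{z\in\mathbb{C}:|z|<1\}$ is the open unit disc. The Bloch space $\mathcal{B}$ consists of all functions $f$ analytic in $\mathbb{D}$ with $\sup_{z\in\mathbb{D}}|f'(z)|(1-|z|^2)<\infty$. For a meromorphic function $w$ in $\mathbb{D}$, the spherical derivative is $w^{\#}=|w'|/(1+|w|^2)$, extended by continuity to the poles of $w$. *)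

(* Defs.v *)
From Stdlib Require Import Reals ClassicalEpsilon.
From Coquelicot Require Import Coquelicot.
Open Scope R_scope.

Definition unit_disc (z : C) : Prop := Cmod z < 1.

Definition sup_disc (F : C -> R) : Rbar :=
  Lub_Rbar (fun y => exists z, unit_disc z /\ y = F z).

Definition inf_disc (F : C -> R) : Rbar :=
  Glb_Rbar (fun y => exists z, unit_disc z /\ y = F z).

(* [ex_derive] is complex differentiability here, the scalars being
   [C_AbsRing].  Functions on the disc are total functions on [C] whose values
   outside the disc are irrelevant. *)
Definition analytic_disc (f : C -> C) : Prop :=
  forall z, unit_disc z -> ex_derive (K := C_AbsRing) (V := C_NormedModule) f z.

Definition Bloch (f : C -> C) : Prop :=
  analytic_disc f /\
  Rbar_lt (sup_disc (fun z => Cmod (C_derive f z) * (1 - Cmod z ^ 2))) p_infty.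

(* [C_derive] is total, so being a solution includes the existence of the two
   derivatives. *)
Definition solution_disc (A f : C -> C) : Prop :=
  analytic_disc f /\ analytic_disc (C_derive f) /\
  forall z, unit_disc z -> (C_derive (C_derive f) z + A z * f z = 0)%C.

Definition lin_indep_disc (f g : C -> C) : Prop :=
  forall a b : C,
    (forall z, unit_disc z -> a * f z + b * g z = 0)%C -> a = 0%C /\ b = 0%C.

(* Depends only on the values of [w] near [z] but not at [z]: for a quotient
   [w] the value at a zero of the denominator is a junk value. *)
Definition pole (w : C -> C) (z : C) : Prop :=
  filterlim (fun u => Cmod (w u)) (locally' z) (Rbar_locally p_infty).

Definition spherical_quotient (w : C -> C) (z : C) : R :=
  Cmod (C_derive w z) / (1 + Cmod (w z) ^ 2).

(* Extended by continuity to the poles: [iota] selects the limit of the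
   quotient at a pole, which exists when [w] is meromorphic near it. *)
Definition spherical_derivative (w : C -> C) (z : C) : R :=
  if excluded_middle_informative (pole w z)
  then iota (T := R_CompleteSpace)
         (fun l : R => filterlim (spherical_quotient w) (locally' z) (locally l))
  else spherical_quotient w z.

(* Main.v *)
Require Import Defs.
From Stdlib Require Import Reals Lra ClassicalEpsilon.
From Coquelicot Require Import Coquelicot.
Open Scope R_scope.

(** Write [W] for the Wronskian [f1' f2 - f1 f2'] and [d > 0] for a lower bound of
    [|f1| + |f2|].

    The spherical derivative of [w = f1 / f2] is an explicit expression.  Where
    [f2] does not vanish, [w' = W / f2^2], so
    [w# = |W| / (|f1|^2 + |f2|^2)].  A zero of [f2] is simple and is not a zero
    of [f1], so it is a pole of [w], and the same formula holds there because
    its right-hand side is continuous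
    ([spherical_derivative_wronskian]).  The equation has no first-order term,
    so [W' = 0] and [W] is constant ([wronskian_const]); it is nonzero, since
    otherwise the combination [f2(0) f1 - f1(0) f2] would solve the equation
    with zero initial data and hence vanish ([wronskian_neq_0], by Gronwall along
    rays).  As [|f1|^2 + |f2|^2 >= d^2 / 2], this gives [w# <= 2 |W| / d^2].

    For the coefficient, [d |A| <= |A| (|f1| + |f2|) = |f1''| + |f2''|], so it is
    enough that [|f''| (1 - |z|^2)^2] is bounded for a Bloch function [f].  This
    is Cauchy's estimate for [f'] on the disc of radius [(1 - |z|) / 2] about
    [z], on which [|f'| = O(1 / (1 - |z|))] ([bloch_second_derivative]).

    Cauchy's estimate is needed only for functions whose derivative is
    continuous, here because [f'' = - A f]; so it has a short proof without path
    integration ([cauchy_estimate]).  If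
    [P(s)] is the integral over [0, 2 pi] of [Re (e^(-it) g (z + s e^(it)))], then
    differentiating in [s], and integrating a derivative in [t] over a full
    period, gives [s P'(s) = P(s)].  Hence [P(s) = s P'(0) = 2 pi s Re g'(z)],
    while [|P(s)|] is at most [2 pi] times the supremum of [|g|]. *)

Local Notation is_C_derive f z d :=
  (is_derive (K := C_AbsRing) (V := C_NormedModule) f z d).

(** * Complex derivatives *)

Lemma Cmod_le_components (x : C) : Cmod x <= Rabs (Re x) + Rabs (Im x).
Proof.
  apply Rsqr_incr_0_var.
  - rewrite !Rsqr_pow2, Cmod2_alt, <- (pow2_abs (Re x)), <- (pow2_abs (Im x)).
    pose proof (Rabs_pos (Re x)); pose proof (Rabs_pos (Im x)); nra.
  - pose proof (Rabs_pos (Re x)); pose proof (Rabs_pos (Im x)); lra.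
Qed.

Lemma im_le_Cmod (x : C) : Rabs (Im x) <= Cmod x.
Proof.
  eapply Rle_trans; [|apply Rmax_Cmod]. apply Rmax_r.
Qed.

Lemma Cmod_triangle_minus (x y : C) : Cmod (x - y) <= Cmod x + Cmod y.
Proof. unfold Cminus. rewrite <- (Cmod_opp y). apply Cmod_triangle. Qed.

(** Complex differentiability uses the metric of [Cmod] on the source and the
    product uniformity on the target; the epsilon form mentions only [Cmod] and
    so hides the difference. *)
Lemma is_C_derive_eps (f : C -> C) (z d : C) :
  is_C_derive f z d <->
  forall eps : posreal, exists delta : posreal, forall u,
    Cmod (u - z) < delta ->
    Cmod (f u - f z - (u - z) * d) <= eps * Cmod (u - z).
Proof.
  split.
  - intros [_ H] eps.
    destruct (H z (fun P HP => HP) eps) as [delta Hd].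
    exists delta. intros u Hu. exact (Hd u Hu).
  - intros H. split.
    + apply is_linear_scal_l.
    + intros x Hx eps.
      rewrite <- (is_filter_lim_locally_unique (V := AbsRing_NormedModule C_AbsRing) z x Hx).
      destruct (H eps) as [delta Hd].
      exists delta. intros u Hu. exact (Hd u Hu).
Qed.

Lemma is_R_derive_eps (f : R -> R) (x d : R) :
  is_derive f x d <->
  forall eps : posreal, exists delta : posreal, forall y,
    Rabs (y - x) < delta ->
    Rabs (f y - f x - (y - x) * d) <= eps * Rabs (y - x).
Proof.
  split.
  - intros [_ H] eps.
    destruct (H x (fun P HP => HP) eps) as [delta Hd].
    exists delta. intros u Hu. exact (Hd u Hu).
  - intros H. split.
    + apply is_linear_scal_l.
    + intros y Hy eps.
      rewrite <- (is_filter_lim_locally_unique (V := R_NormedModule) x y Hy).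
      destruct (H eps) as [delta Hd].
      exists delta. intros u Hu. exact (Hd u Hu).
Qed.

(** The two normed modules on [C] share their norm but not their uniform space,
    so they are not convertible; the product and composition rules are stated
    for the second one. *)
Lemma is_C_derive_AbsRing (f : C -> C) (z d : C) :
  is_C_derive f z d <->
  is_derive (K := C_AbsRing) (V := AbsRing_NormedModule C_AbsRing) f z d.
Proof.
  split; intros [[H1 H2 H3] H]; (split; [constructor; assumption | exact H]).
Qed.

Lemma is_C_derive_mult (f g : C -> C) (z df dg : C) :
  is_C_derive f z df -> is_C_derive g z dg ->
  is_C_derive (fun u => f u * g u)%C z (df * g z + f z * dg)%C.
Proof.
  rewrite !is_C_derive_AbsRing. intros Hf Hg.
  apply (is_derive_mult (K := C_AbsRing) f g z df dg Hf Hg Cmult_comm).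
Qed.

Lemma is_C_derive_plus (f g : C -> C) (z df dg : C) :
  is_C_derive f z df -> is_C_derive g z dg ->
  is_C_derive (fun u => f u + g u)%C z (df + dg)%C.
Proof. exact (is_derive_plus (V := C_NormedModule) f g z df dg). Qed.

Lemma is_C_derive_minus (f g : C -> C) (z df dg : C) :
  is_C_derive f z df -> is_C_derive g z dg ->
  is_C_derive (fun u => f u - g u)%C z (df - dg)%C.
Proof. exact (is_derive_minus (V := C_NormedModule) f g z df dg). Qed.

Lemma is_C_derive_const (c z : C) : is_C_derive (fun _ => c) z (RtoC 0).
Proof. exact (is_derive_const (V := C_NormedModule) c z). Qed.

Lemma is_C_derive_scal (f : C -> C) (c z df : C) :
  is_C_derive f z df -> is_C_derive (fun u => c * f u)%C z (c * df)%C.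
Proof.
  intros Hf. pose proof (is_C_derive_mult (fun _ => c) f z _ _ (is_C_derive_const c z) Hf) as H.
  replace (c * df)%C with (0 * f z + c * df)%C by ring. exact H.
Qed.

Lemma is_C_derive_inv (z : C) :
  z <> 0%C -> is_C_derive Cinv z (- / (z * z))%C.
Proof.
  intros Hz. apply is_C_derive_eps. intros eps.
  assert (Hm : 0 < Cmod z) by now apply Cmod_gt_0.
  pose proof (cond_pos eps) as He.
  assert (Hd : 0 < Rmin (Cmod z / 2) (eps * Cmod z ^ 3 / 2)).
  { apply Rmin_pos; [lra|].
    pose proof (Rmult_lt_0_compat _ _ He (pow_lt _ 3 Hm)). lra. }
  exists (mkposreal _ Hd). cbn [pos]. intros u Hu.
  pose proof (Rmin_l (Cmod z / 2) (eps * Cmod z ^ 3 / 2)) as H1.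
  pose proof (Rmin_r (Cmod z / 2) (eps * Cmod z ^ 3 / 2)) as H2.
  assert (Hu2 : Cmod z / 2 <= Cmod u).
  { pose proof (Cmod_triangle_minus u (u - z)) as H3.
    replace (u - (u - z))%C with z in H3 by ring. lra. }
  assert (Hu0 : u <> 0%C) by (apply Cmod_gt_0; lra).
  replace (/ u - / z - (u - z) * - / (z * z))%C
    with ((u - z) * ((u - z) * / (u * (z * z))))%C by (field; auto).
  rewrite !Cmod_mult, Cmod_inv, !Cmod_mult by (repeat apply Cmult_neq_0; auto).
  rewrite (Rmult_comm eps).
  apply Rmult_le_compat_l; [apply Cmod_ge_0|].
  apply Rle_div_l; [repeat apply Rmult_lt_0_compat; lra|].
  assert (0 < eps * (Cmod z * Cmod z)) by (repeat apply Rmult_lt_0_compat; lra).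
  assert (eps * (Cmod z * Cmod z) * (Cmod z / 2) <= eps * (Cmod z * Cmod z) * Cmod u)
    by (apply Rmult_le_compat_l; lra).
  lra.
Qed.

Lemma is_C_derive_div (f g : C -> C) (z df dg : C) :
  is_C_derive f z df -> is_C_derive g z dg -> g z <> 0%C ->
  is_C_derive (fun u => f u / g u)%C z ((df * g z - f z * dg) / (g z * g z))%C.
Proof.
  intros Hf Hg Hz.
  assert (Hi : is_C_derive (fun u => / g u)%C z (dg * - / (g z * g z))%C).
  { apply (is_derive_comp (V := C_NormedModule) Cinv g).
    - now apply is_C_derive_inv.
    - now apply is_C_derive_AbsRing. }
  pose proof (is_C_derive_mult _ _ _ _ _ Hf Hi) as H.
  replace ((df * g z - f z * dg) / (g z * g z))%C
    with (df * / g z + f z * (dg * - / (g z * g z)))%C by (field; auto).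
  exact H.
Qed.

Lemma is_C_derive_continuous (f : C -> C) (z d : C) :
  is_C_derive f z d -> continuous f z.
Proof.
  intros H P HP. apply locally_C.
  apply (ex_derive_continuous (K := C_AbsRing) (V := C_NormedModule)).
  - now exists d.
  - exact HP.
Qed.

(** * Derivatives along real paths *)

(** Componentwise, so that results on real functions of a real variable apply
    directly to the two parts. *)
Definition is_path_derive (gam : R -> C) (t : R) (v : C) : Prop :=
  is_derive (fun s => Re (gam s)) t (Re v) /\
  is_derive (fun s => Im (gam s)) t (Im v).

Lemma is_path_derive_eps (gam : R -> C) (t : R) (v : C) :
  is_path_derive gam t v <->
  forall eps : posreal, exists delta : posreal, forall s,
    Rabs (s - t) < delta ->
    Cmod (gam s - gam t - (s - t)%R * v) <= eps * Rabs (s - t).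
Proof.
  unfold is_path_derive. rewrite !is_R_derive_eps.
  assert (HR : forall s, Re (gam s - gam t - (s - t)%R * v)
               = Re (gam s) - Re (gam t) - (s - t) * Re v).
  { intros s. unfold Re, Im; simpl; ring. }
  assert (HI : forall s, Im (gam s - gam t - (s - t)%R * v)
               = Im (gam s) - Im (gam t) - (s - t) * Im v).
  { intros s. unfold Re, Im; simpl; ring. }
  split.
  - intros [H1 H2] eps.
    assert (He : 0 < eps / 2) by (destruct eps; simpl; lra).
    destruct (H1 (mkposreal _ He)) as [d1 Hd1].
    destruct (H2 (mkposreal _ He)) as [d2 Hd2].
    exists (mkposreal _ (Rmin_pos _ _ (cond_pos d1) (cond_pos d2))).
    intros s Hs. cbn [pos] in *.
    eapply Rle_trans; [apply Cmod_le_components|].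
    rewrite HR, HI.
    specialize (Hd1 s (Rlt_le_trans _ _ _ Hs (Rmin_l _ _))).
    specialize (Hd2 s (Rlt_le_trans _ _ _ Hs (Rmin_r _ _))). lra.
  - intros H. split; intros eps; destruct (H eps) as [d Hd]; exists d; intros s Hs;
      (eapply Rle_trans; [|apply (Hd s Hs)]).
    + rewrite <- HR. apply re_le_Cmod.
    + rewrite <- HI. apply im_le_Cmod.
Qed.

Lemma is_path_derive_comp (f : C -> C) (gam : R -> C) (t : R) (d v : C) :
  is_C_derive f (gam t) d -> is_path_derive gam t v ->
  is_path_derive (fun s => f (gam s)) t (v * d)%C.
Proof.
  rewrite is_C_derive_eps, !is_path_derive_eps. intros Hf Hg eps.
  pose proof (cond_pos eps) as He.
  pose proof (Cmod_ge_0 d) as Hd. pose proof (Cmod_ge_0 v) as Hv.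
  assert (H2 : 0 < eps / (2 * (Cmod v + 1))) by (apply Rdiv_lt_0_compat; lra).
  assert (H1 : 0 < Rmin 1 (eps / (2 * (Cmod d + 1)))).
  { apply Rmin_pos; [lra|]. apply Rdiv_lt_0_compat; lra. }
  destruct (Hf (mkposreal _ H2)) as [d2 Hd2].
  destruct (Hg (mkposreal _ H1)) as [d1 Hd1].
  assert (H3 : 0 < Rmin d1 (d2 / (Cmod v + 1))).
  { apply Rmin_pos; [apply cond_pos|]. apply Rdiv_lt_0_compat; [apply cond_pos|lra]. }
  exists (mkposreal _ H3). cbn [pos] in *. intros s Hs.
  specialize (Hd1 s (Rlt_le_trans _ _ _ Hs (Rmin_l _ _))).
  pose proof (Rlt_le_trans _ _ _ Hs (Rmin_r _ _)) as Hs2.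
  apply Rlt_div_r in Hs2; [|lra].
  pose proof (Rabs_pos (s - t)) as Hst.
  pose proof (Rmin_l 1 (eps / (2 * (Cmod d + 1)))) as Hm1.
  pose proof (Rmin_r 1 (eps / (2 * (Cmod d + 1)))) as Hm2.
  assert (Hinc : Cmod (gam s - gam t) <= (Cmod v + 1) * Rabs (s - t)).
  { replace (gam s - gam t)%C
      with ((gam s - gam t - (s - t)%R * v) + (s - t)%R * v)%C by ring.
    eapply Rle_trans; [apply Cmod_triangle|].
    rewrite Cmod_mult, Cmod_R.
    assert (Rmin 1 (eps / (2 * (Cmod d + 1))) * Rabs (s - t) <= 1 * Rabs (s - t))
      by (apply Rmult_le_compat_r; lra).
    lra. }
  specialize (Hd2 (gam s)).
  assert (Hlt : Cmod (gam s - gam t) < d2) by lra.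
  specialize (Hd2 Hlt).
  replace (f (gam s) - f (gam t) - (s - t)%R * (v * d))%C
    with ((f (gam s) - f (gam t) - (gam s - gam t) * d)
          + (gam s - gam t - (s - t)%R * v) * d)%C by ring.
  eapply Rle_trans; [apply Cmod_triangle|]. rewrite Cmod_mult.
  assert (Ha : eps / (2 * (Cmod v + 1)) * Cmod (gam s - gam t) <= eps / 2 * Rabs (s - t)).
  { replace (eps / 2 * Rabs (s - t))
      with (eps / (2 * (Cmod v + 1)) * ((Cmod v + 1) * Rabs (s - t))) by (field; lra).
    apply Rmult_le_compat_l; lra. }
  assert (Hb : Cmod (gam s - gam t - (s - t)%R * v) * Cmod d <= eps / 2 * Rabs (s - t)).
  { apply Rle_trans with (eps / (2 * (Cmod d + 1)) * Rabs (s - t) * (Cmod d + 1)).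
    - apply Rmult_le_compat; [apply Cmod_ge_0|lra| |lra].
      eapply Rle_trans; [exact Hd1|]. apply Rmult_le_compat_r; lra.
    - right; field; lra. }
  lra.
Qed.

Lemma is_path_derive_mult (a b : R -> C) (t : R) (da db : C) :
  is_path_derive a t da -> is_path_derive b t db ->
  is_path_derive (fun s => a s * b s)%C t (da * b t + a t * db)%C.
Proof.
  intros [Ha1 Ha2] [Hb1 Hb2]. split.
  - apply (is_derive_ext (fun s => Re (a s) * Re (b s) - Im (a s) * Im (b s))).
    { intros s. now rewrite re_mult. }
    evar_last.
    + apply (is_derive_minus (V := R_NormedModule));
        apply (is_derive_mult (K := R_AbsRing)); try eassumption; exact Rmult_comm.
    + unfold minus, plus, opp, mult, Re, Im; simpl. ring.
  - apply (is_derive_ext (fun s => Re (a s) * Im (b s) + Im (a s) * Re (b s))).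
    { intros s. now rewrite im_mult. }
    evar_last.
    + apply (is_derive_plus (V := R_NormedModule));
        apply (is_derive_mult (K := R_AbsRing)); try eassumption; exact Rmult_comm.
    + unfold plus, opp, mult, Re, Im; simpl. ring.
Qed.

(** * Cauchy's estimate for a holomorphic function with continuous derivative *)

Definition cis (t : R) : C := (cos t, sin t).

Lemma Cmod_cis (t : R) : Cmod (cis t) = 1.
Proof.
  unfold Cmod, cis; simpl. transitivity (sqrt 1); [f_equal | apply sqrt_1].
  pose proof (sin2_cos2 t). unfold Rsqr in *. lra.
Qed.

Lemma cis_opp_mult (t : R) : (cis (- t) * cis t)%C = 1%C.
Proof.
  unfold cis. rewrite cos_neg, sin_neg. apply injective_projections; simpl; [|ring].
  pose proof (sin2_cos2 t). unfold Rsqr in *. lra.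
Qed.

Lemma is_path_derive_cis_opp (t : R) :
  is_path_derive (fun s => cis (- s)) t (- (Ci * cis (- t)))%C.
Proof.
  split; unfold Re, Im, cis; simpl; auto_derive; auto; ring.
Qed.

Lemma is_path_derive_radius (z : C) (s t : R) :
  is_path_derive (fun u => z + u * cis t)%C s (cis t).
Proof.
  split; unfold Re, Im, cis; simpl; auto_derive; auto; ring.
Qed.

Lemma is_path_derive_circle (z : C) (s t : R) :
  is_path_derive (fun u => z + s * cis u)%C t (Ci * (s * cis t))%C.
Proof.
  split; unfold Re, Im, cis; simpl; auto_derive; auto; ring.
Qed.

Lemma Cmod_circle (z : C) (s t : R) : Cmod (z + s * cis t - z) = Rabs s.
Proof.
  replace (z + s * cis t - z)%C with (s * cis t)%C by ring.
  rewrite Cmod_mult, Cmod_cis, Cmod_R. ring.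
Qed.

Lemma continuous_polar (z : C) (s t : R) :
  continuous (fun p : R * R => z + fst p * cis (snd p))%C (s, t).
Proof.
  apply (continuous_ext (fun p : R * R =>
    (Re z + fst p * cos (snd p), Im z + fst p * sin (snd p)))).
  { intros p. apply injective_projections; unfold Re, Im; simpl; ring. }
  assert (Hc : forall (h : R -> R) (x : R), (forall y, ex_derive h y) ->
    continuous (fun p : R * R => x + fst p * h (snd p)) (s, t)).
  { intros h x Hh.
    apply (continuous_plus (V := R_NormedModule)); [apply continuous_const|].
    apply (continuous_mult (K := R_AbsRing)); [apply continuous_fst|].
    apply (continuous_comp snd h); [apply continuous_snd|].
    apply (ex_derive_continuous (V := R_NormedModule)), Hh. }
  apply (continuous_comp_2 (U := prod_UniformSpace R_UniformSpace R_UniformSpace)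
           (V := R_UniformSpace) (W := R_UniformSpace) (X := C_UniformSpace)
           (fun p => Re z + fst p * cos (snd p)) (fun p => Im z + fst p * sin (snd p)) pair).
  - apply Hc. intros y; auto_derive; auto.
  - apply Hc. intros y; auto_derive; auto.
  - apply (continuous_ext (fun x => x)); [now intros [x y] | apply continuous_id].
Qed.

(** The real part suffices: multiplying [g] by a unimodular constant makes the
    derivative at the centre a nonnegative real. *)
Definition circle_integrand (g : C -> C) (z : C) (s t : R) : R :=
  Re (cis (- t) * g (z + s * cis t)%C).

(** With [h] the derivative of [g], this is the radial derivative of
    [circle_integrand g]: the factors [e^(-it)] and [e^(it)] cancel. *)
Definition circle_Re (h : C -> C) (z : C) (s t : R) : R := Re (h (z + s * cis t)%C).

Definition circle_moment (g : C -> C) (z : C) (s : R) : R :=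
  RInt (circle_integrand g z s) 0 (2 * PI).

Section Cauchy.

Variables (g g' : C -> C) (z : C) (R0 : R).
Hypothesis Hg : forall u, Cmod (u - z) < R0 -> is_C_derive g u (g' u).
Hypothesis Hg' : forall u, Cmod (u - z) < R0 -> continuous g' u.

Lemma circle_in_disc (s t : R) : Rabs s < R0 -> Cmod (z + s * cis t - z) < R0.
Proof. now rewrite Cmod_circle. Qed.

Lemma circle_integrand_radial_derive (s t : R) :
  Rabs s < R0 -> is_derive (fun u => circle_integrand g z u t) s (circle_Re g' z s t).
Proof.
  intros Hs.
  assert (H : is_path_derive (fun u => cis (- t) * g (z + u * cis t))%C s
                (0 * g (z + s * cis t) + cis (- t) * (cis t * g' (z + s * cis t)))%C).
  { apply (is_path_derive_mult (fun _ => cis (- t))).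
    - split; apply (is_derive_const (V := R_NormedModule)).
    - apply (is_path_derive_comp g); [now apply Hg, circle_in_disc|].
      apply is_path_derive_radius. }
  replace (0 * g (z + s * cis t) + cis (- t) * (cis t * g' (z + s * cis t)))%C
    with (g' (z + s * cis t)) in H.
  - apply H.
  - rewrite Cmult_assoc, cis_opp_mult. ring.
Qed.

(** Rotation multiplies by [i] what scaling does radially, so this derivative
    contains both [circle_Re g'] and [circle_integrand g] in its imaginary
    part. *)
Lemma circle_integrand_angular_derive (s t : R) :
  Rabs s < R0 ->
  is_path_derive (fun u => cis (- u) * g (z + s * cis u))%C t
    (Ci * (s * g' (z + s * cis t) - cis (- t) * g (z + s * cis t)))%C.
Proof.
  intros Hs.
  replace (Ci * (s * g' (z + s * cis t) - cis (- t) * g (z + s * cis t)))%C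
    with (- (Ci * cis (- t)) * g (z + s * cis t)
          + cis (- t) * (Ci * (s * cis t) * g' (z + s * cis t)))%C.
  - apply (is_path_derive_mult (fun u => cis (- u))).
    + apply is_path_derive_cis_opp.
    + apply (is_path_derive_comp g); [now apply Hg, circle_in_disc|].
      apply is_path_derive_circle.
  - transitivity (Ci * (s * (cis (- t) * cis t) * g' (z + s * cis t)
                        - cis (- t) * g (z + s * cis t)))%C; [ring|].
    rewrite cis_opp_mult. ring.
Qed.

Lemma circle_integrand_continuous (s t : R) :
  Rabs s < R0 -> continuous (circle_integrand g z s) t.
Proof.
  intros Hs. apply (ex_derive_continuous (V := R_NormedModule)).
  eexists. apply (circle_integrand_angular_derive s t Hs).
Qed.

Lemma circle_Re_continuous_2d (s t : R) :
  Rabs s < R0 -> continuous (fun p : R * R => circle_Re g' z (fst p) (snd p)) (s, t).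
Proof.
  intros Hs.
  apply (continuous_comp (fun p : R * R => g' (z + fst p * cis (snd p)))%C Re).
  - apply (continuous_comp (fun p : R * R => z + fst p * cis (snd p))%C g').
    + apply continuous_polar.
    + now apply Hg', circle_in_disc.
  - simpl. destruct (g' (z + s * cis t)) as [x y]. apply continuous_fst.
Qed.

Lemma circle_Re_continuous (s t : R) : Rabs s < R0 -> continuous (circle_Re g' z s) t.
Proof.
  intros Hs.
  apply (continuous_comp_2 (fun _ => s) (fun u => u) (circle_Re g' z)).
  - apply continuous_const.
  - apply continuous_id.
  - now apply circle_Re_continuous_2d.
Qed.

Lemma locally_Rabs_lt (s : R) : Rabs s < R0 -> locally s (fun u => Rabs u < R0).
Proof.
  intros Hs. assert (H : 0 < R0 - Rabs s) by lra.
  exists (mkposreal _ H). intros u Hu.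
  change (Rabs (u - s) < R0 - Rabs s) in Hu.
  pose proof (Rabs_triang_inv u s). lra.
Qed.

Lemma circle_moment_derive (s : R) :
  Rabs s < R0 -> is_derive (circle_moment g z) s (RInt (circle_Re g' z s) 0 (2 * PI)).
Proof.
  intros Hs. unfold circle_moment.
  replace (RInt (circle_Re g' z s) 0 (2 * PI))
    with (RInt (fun t => Derive (fun u => circle_integrand g z u t) s) 0 (2 * PI)).
  2: { apply RInt_ext. intros t _. apply is_derive_unique, circle_integrand_radial_derive, Hs. }
  apply (is_derive_RInt_param (circle_integrand g z)).
  - apply filter_imp with (2 := locally_Rabs_lt s Hs). intros u Hu t _.
    eexists. now apply circle_integrand_radial_derive.
  - intros t _. apply (continuity_2d_pt_ext_loc (circle_Re g' z)).
    + destruct (locally_Rabs_lt s Hs) as [d Hd]. exists d.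
      intros u v Hu _. symmetry. apply is_derive_unique, circle_integrand_radial_derive.
      now apply Hd.
    + apply continuity_2d_pt_filterlim. now apply circle_Re_continuous_2d.
  - apply filter_imp with (2 := locally_Rabs_lt s Hs). intros u Hu.
    apply (ex_RInt_continuous (V := R_CompleteNormedModule)).
    intros t _. now apply circle_integrand_continuous.
Qed.

(** The difference [s circle_Re g' - circle_integrand g] is the derivative in
    the angle of the [2 pi]-periodic function [Im (e^(-it) g (z + s e^(it)))], so its
    integral over a period vanishes. *)
Lemma circle_moment_euler (s : R) :
  Rabs s < R0 ->
  s * RInt (circle_Re g' z s) 0 (2 * PI) = circle_moment g z s.
Proof.
  intros Hs.
  assert (HintRe : ex_RInt (circle_Re g' z s) 0 (2 * PI)).
  { apply (ex_RInt_continuous (V := R_CompleteNormedModule)).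
    intros t _. now apply circle_Re_continuous. }
  assert (HF : ex_RInt (circle_integrand g z s) 0 (2 * PI)).
  { apply (ex_RInt_continuous (V := R_CompleteNormedModule)).
    intros t _. now apply circle_integrand_continuous. }
  set (H := fun u => Im (cis (- u) * g (z + s * cis u))).
  assert (Hint : is_RInt (fun t => s * circle_Re g' z s t - circle_integrand g z s t) 0 (2 * PI)
                   (minus (H (2 * PI)) (H 0))).
  { apply (is_RInt_derive (V := R_CompleteNormedModule)).
    - intros t _.
      destruct (circle_integrand_angular_derive s t Hs) as [_ Him].
      evar_last; [exact Him|].
      unfold circle_integrand, circle_Re. rewrite im_mult. unfold Re, Im; simpl. ring.
    - intros t _. apply (continuous_minus (V := R_NormedModule)).
      + apply (continuous_scal_r (V := R_NormedModule)). now apply circle_Re_continuous.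
      + now apply circle_integrand_continuous. }
  assert (Hper : H (2 * PI) = H 0).
  { unfold H, cis. rewrite !cos_neg, !sin_neg, cos_2PI, sin_2PI, cos_0, sin_0.
    reflexivity. }
  assert (Hint' : is_RInt (fun t => s * circle_Re g' z s t - circle_integrand g z s t) 0 (2 * PI)
                    (s * RInt (circle_Re g' z s) 0 (2 * PI) - circle_moment g z s)).
  { exact (is_RInt_minus (V := R_NormedModule) _ _ _ _ _ _
             (is_RInt_scal _ _ _ s _ (RInt_correct _ _ _ HintRe)) (RInt_correct _ _ _ HF)). }
  apply (is_RInt_unique (V := R_CompleteNormedModule)) in Hint, Hint'.
  rewrite Hint in Hint'. rewrite Hper in Hint'.
  unfold minus, plus, opp in Hint'; simpl in Hint'. lra.
Qed.

(** By the preceding identity the moment divided by the radius is constant on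
    [(0, R0)]; its limit at [0] is the derivative of the moment there. *)
Lemma circle_moment_linear (s : R) :
  0 < s < R0 -> circle_moment g z s = s * (2 * PI * Re (g' z)).
Proof.
  intros Hs.
  assert (H0 : Rabs 0 < R0) by (rewrite Rabs_R0; lra).
  assert (Hconst : forall a, 0 < a <= s -> circle_moment g z a / a = circle_moment g z s / s).
  { intros a Ha.
    destruct (MVT_gen (fun u => circle_moment g z u / u) a s (fun _ => 0)) as [c [_ Hc]].
    - rewrite Rmin_left, Rmax_right by lra. intros x Hx.
      assert (Hx0 : Rabs x < R0) by (rewrite Rabs_pos_eq; lra).
      evar_last.
      + apply (is_derive_div (circle_moment g z) (fun u => u));
          [now apply circle_moment_derive | apply (is_derive_id (K := R_AbsRing)) | lra].
      + rewrite <- (circle_moment_euler x Hx0). unfold one; simpl. field. lra.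
    - rewrite Rmin_left, Rmax_right by lra. intros x Hx.
      assert (Hx0 : Rabs x < R0) by (rewrite Rabs_pos_eq; lra).
      apply continuity_pt_filterlim.
      apply (ex_derive_continuous (V := R_NormedModule) (fun u => circle_moment g z u / u)).
      eexists. apply (is_derive_div (circle_moment g z) (fun u => u));
          [now apply circle_moment_derive | apply (is_derive_id (K := R_AbsRing)) | lra].
    - lra. }
  assert (Hmom0 : circle_moment g z 0 = 0) by (rewrite <- (circle_moment_euler 0 H0); ring).
  assert (HD : RInt (circle_Re g' z 0) 0 (2 * PI) = 2 * PI * Re (g' z)).
  { rewrite (RInt_ext (circle_Re g' z 0) (fun _ => Re (g' z))).
    - rewrite RInt_const. unfold scal; simpl. unfold mult; simpl. ring.
    - intros t _. unfold circle_Re. f_equal. f_equal. ring. }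
  pose proof (circle_moment_derive 0 H0) as Hd. rewrite HD, is_R_derive_eps in Hd.
  set (D := 2 * PI * Re (g' z)) in *.
  assert (Hq : circle_moment g z s / s = D).
  { apply Rminus_diag_uniq. apply cond_eq. intros eps Heps.
    assert (He2 : 0 < eps / 2) by lra.
    destruct (Hd (mkposreal _ He2)) as [d Hdd]. cbn [pos] in Hdd.
    (* Any radius at most [s] and below [d] shows how close the constant is to [D]. *)
    set (a := Rmin s (d / 2)).
    pose proof (cond_pos d) as Hdpos.
    assert (Ha : 0 < a) by (apply Rmin_pos; lra).
    assert (Has : a <= s) by apply Rmin_l.
    assert (Had : a <= d / 2) by apply Rmin_r.
    specialize (Hdd a). rewrite Rminus_0_r, (Rabs_pos_eq a) in Hdd by lra.
    specialize (Hdd ltac:(lra)).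
    rewrite Hmom0 in Hdd.
    replace (circle_moment g z a - 0 - a * D) with (a * (circle_moment g z s / s - D)) in Hdd.
    2: { rewrite <- (Hconst a) by lra. field. lra. }
    rewrite Rabs_mult, (Rabs_pos_eq a), Rmult_comm in Hdd by lra.
    apply Rmult_le_reg_r in Hdd; [|exact Ha].
    rewrite Rminus_0_r. lra. }
  rewrite <- Hq. field. lra.
Qed.

Lemma cauchy_formula_Re (s : R) :
  0 < s < R0 ->
  is_RInt (fun t => Re (cis (- t) * g (z + s * cis t))) 0 (2 * PI)
    (s * (2 * PI * Re (g' z))).
Proof.
  intros Hs. rewrite <- circle_moment_linear by exact Hs.
  apply (RInt_correct (V := R_CompleteNormedModule) (circle_integrand g z s)).
  apply (ex_RInt_continuous (V := R_CompleteNormedModule)).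
  intros t _. apply circle_integrand_continuous. rewrite Rabs_pos_eq; lra.
Qed.

End Cauchy.

Lemma cauchy_estimate (g g' : C -> C) (z : C) (R0 M s : R) :
  (forall u, Cmod (u - z) < R0 -> is_C_derive g u (g' u)) ->
  (forall u, Cmod (u - z) < R0 -> continuous g' u) ->
  (forall u, Cmod (u - z) < R0 -> Cmod (g u) <= M) ->
  0 < s < R0 -> s * Cmod (g' z) <= M.
Proof.
  intros Hg Hg' HM Hs.
  destruct (Ceq_dec (g' z) 0) as [Hz|Hz].
  { rewrite Hz, Cmod_0, Rmult_0_r.
    eapply Rle_trans; [apply Cmod_ge_0|]. apply (HM z).
    replace (z - z)%C with (RtoC 0) by ring. rewrite Cmod_0. lra. }
  assert (Hm : 0 < Cmod (g' z)) by now apply Cmod_gt_0.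
  (* The unimodular factor that turns [g' z] into its modulus. *)
  set (lam := (Cconj (g' z) / Cmod (g' z))%C).
  assert (Hc0 : RtoC (Cmod (g' z)) <> 0%C) by (intros H; apply RtoC_inj in H; lra).
  assert (Hlam : Cmod lam = 1).
  { unfold lam. rewrite Cmod_div, Cmod_conj, Cmod_R, Rabs_pos_eq by (auto; lra). field. lra. }
  assert (Hre : Re (lam * g' z) = Cmod (g' z)).
  { replace (lam * g' z)%C with (RtoC (Cmod (g' z))); [apply re_RtoC|].
    unfold lam.
    replace (Cconj (g' z) / Cmod (g' z) * g' z)%C
      with ((g' z * Cconj (g' z)) / Cmod (g' z))%C by (field; auto).
    rewrite <- Cmod2_conj. rewrite RtoC_pow. field; auto. }
  assert (HI : is_RInt (fun t => Re (cis (- t) * (lam * g (z + s * cis t)%C))) 0 (2 * PI)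
                 (s * (2 * PI * Re (lam * g' z)))).
  { apply (cauchy_formula_Re (fun u => lam * g u)%C (fun u => lam * g' u)%C z R0); [| |exact Hs].
    - intros u Hu. now apply is_C_derive_scal, Hg.
    - intros u Hu P HP.
      apply (continuous_comp g' (fun v => lam * v)%C); [now apply Hg'| |exact HP].
      eapply is_C_derive_continuous.
      apply is_C_derive_scal. apply is_C_derive_AbsRing.
      apply (is_derive_id (K := C_AbsRing)). }
  assert (Hb : forall t, 0 <= t <= 2 * PI ->
    Rabs (Re (cis (- t) * (lam * g (z + s * cis t)%C))) <= M).
  { intros t _.
    eapply Rle_trans; [apply re_le_Cmod|].
    rewrite !Cmod_mult, Cmod_cis, Hlam, !Rmult_1_l.
    apply HM. rewrite Cmod_circle, Rabs_pos_eq; lra. }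
  pose proof PI_RGT_0 as Hpi.
  pose proof (norm_RInt_le_const (V := R_NormedModule) _ 0 (2 * PI) _ M ltac:(lra) Hb HI) as Hle.
  rewrite Hre in Hle.
  change norm with Rabs in Hle.
  pose proof (Rle_trans _ _ _ (Rle_abs _) Hle) as Hle2.
  apply (Rmult_le_reg_l (2 * PI)); lra.
Qed.

(** * Linear differential equations along rays of the disc *)

Lemma is_derive_Cmod2 (gam : R -> C) (t : R) (v : C) :
  is_path_derive gam t v ->
  is_derive (fun s => Cmod (gam s) ^ 2) t (2 * Re (Cconj (gam t) * v)).
Proof.
  intros [H1 H2].
  apply (is_derive_ext (fun s => Re (gam s) * Re (gam s) + Im (gam s) * Im (gam s))).
  { intros s. rewrite Cmod2_alt. simpl; ring. }
  evar_last.
  - apply (is_derive_plus (V := R_NormedModule));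
      apply (is_derive_mult (K := R_AbsRing)); try eassumption; exact Rmult_comm.
  - unfold plus, mult, Re, Im; simpl. ring.
Qed.

Lemma is_path_derive_ray (z : C) (t : R) : is_path_derive (fun s => s * z)%C t z.
Proof.
  split; unfold Re, Im; simpl; auto_derive; auto; ring.
Qed.

Lemma unit_disc_ray (z : C) (t : R) :
  unit_disc z -> 0 <= t <= 1 -> unit_disc (t * z)%C.
Proof.
  unfold unit_disc. intros Hz Ht. rewrite Cmod_mult, Cmod_R, Rabs_pos_eq by lra.
  pose proof (Cmod_ge_0 z). nra.
Qed.

Lemma nonpos_derive_le (E E' : R -> R) :
  (forall t, 0 <= t <= 1 -> is_derive E t (E' t)) ->
  (forall t, 0 <= t <= 1 -> E' t <= 0) -> E 1 <= E 0.
Proof.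
  intros HE HE'.
  destruct (MVT_gen E 0 1 E') as [c [Hc Heq]].
  - rewrite Rmin_left, Rmax_right by lra. intros x Hx. apply HE; lra.
  - rewrite Rmin_left, Rmax_right by lra. intros x Hx.
    apply continuity_pt_filterlim.
    apply (ex_derive_continuous (V := R_NormedModule) E). eexists. now apply HE.
  - rewrite Rmin_left, Rmax_right in Hc by lra.
    specialize (HE' c Hc). lra.
Qed.

(** The function [E(t) e^(-Kt)] is nonincreasing. *)
Lemma gronwall_zero (E E' : R -> R) (K : R) :
  (forall t, 0 <= t <= 1 -> is_derive E t (E' t)) ->
  (forall t, 0 <= t <= 1 -> E' t <= K * E t) -> E 0 = 0 -> E 1 <= 0.
Proof.
  intros HE HE' H0.
  assert (H : E 1 * exp (- K * 1) <= E 0 * exp (- K * 0)).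
  { apply (nonpos_derive_le (fun t => E t * exp (- K * t))
             (fun t => (E' t - K * E t) * exp (- K * t))).
    - intros t Ht. evar_last.
      + apply (is_derive_mult (K := R_AbsRing) E (fun s => exp (- K * s)));
          [now apply HE | | exact Rmult_comm].
        apply (is_derive_comp exp); [apply is_derive_exp|].
        apply is_derive_scal, (is_derive_id (K := R_AbsRing)).
      + unfold plus, mult, scal, one; simpl. unfold mult; simpl. ring.
    - intros t Ht. specialize (HE' t Ht). pose proof (exp_pos (- K * t)). nra. }
  rewrite H0, Rmult_0_l in H. pose proof (exp_pos (- K * 1)). nra.
Qed.

Lemma zero_derive_const (f : C -> C) :
  (forall z, unit_disc z -> is_C_derive f z (RtoC 0)) ->
  forall z, unit_disc z -> f z = f 0%C.
Proof.
  intros Hf z Hz.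
  assert (Hp : forall t, 0 <= t <= 1 -> is_path_derive (fun s => f (s * z)%C) t (RtoC 0)).
  { intros t Ht. replace (RtoC 0) with (z * 0)%C by ring.
    apply (is_path_derive_comp f); [now apply Hf, unit_disc_ray|].
    apply is_path_derive_ray. }
  assert (Hneg : forall (h : R -> R), (forall t, 0 <= t <= 1 -> is_derive h t 0) -> h 1 = h 0).
  { intros h Hh. apply Rle_antisym.
    - apply (nonpos_derive_le h (fun _ => 0)); [exact Hh | intros; lra].
    - apply Ropp_le_cancel.
      apply (nonpos_derive_le (fun t => - h t) (fun _ => - 0)); [|intros; lra].
      intros t Ht. now apply (is_derive_opp (V := R_NormedModule) h), Hh. }
  replace z with (1 * z)%C by ring.
  replace (RtoC 0) with (0 * z)%C by ring.
  apply injective_projections.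
  - apply (Hneg (fun s => Re (f (s * z)%C))). intros t Ht. apply (Hp t Ht).
  - apply (Hneg (fun s => Im (f (s * z)%C))). intros t Ht. apply (Hp t Ht).
Qed.

Lemma analytic_bounded_ray (A : C -> C) (z : C) :
  analytic_disc A -> unit_disc z ->
  exists M, forall t, 0 <= t <= 1 -> Cmod (A (t * z)%C) <= M.
Proof.
  intros HA Hz.
  destruct (continuity_ab_maj (fun t => Cmod (A (t * z)%C) ^ 2) 0 1) as [m [Hm _]].
  - lra.
  - intros t Ht. apply continuity_pt_filterlim.
    apply (ex_derive_continuous (V := R_NormedModule) (fun t => Cmod (A (t * z)%C) ^ 2)).
    destruct (HA _ (unit_disc_ray z t Hz Ht)) as [d Hd].
    eexists. apply (is_derive_Cmod2 (fun s => A (s * z)%C)).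
    eapply (is_path_derive_comp A); [exact Hd | apply is_path_derive_ray].
  - exists (1 + Cmod (A (m * z)%C) ^ 2). intros t Ht. specialize (Hm t Ht).
    pose proof (Cmod_ge_0 (A (t * z)%C)). simpl in Hm |- *. nra.
Qed.

(** Along the ray to [z] the energy [|f|^2 + |h|^2] satisfies Gronwall's
    inequality, with [1 + M] as constant when [|A| <= M] there.  The equation is
    taken as a first-order system in [f] and [h = f'] so that linear combinations
    of solutions need no computation of [C_derive]. *)
Lemma ode_zero_unique (A f h : C -> C) :
  analytic_disc A ->
  (forall z, unit_disc z -> is_C_derive f z (h z)) ->
  (forall z, unit_disc z -> is_C_derive h z (- (A z * f z))%C) ->
  f 0%C = 0%C -> h 0%C = 0%C ->
  forall z, unit_disc z -> f z = 0%C.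
Proof.
  intros HA Hf Hh Hf0 Hh0 z Hz.
  destruct (analytic_bounded_ray A z HA Hz) as [M HM].
  set (p := fun t : R => f (t * z)%C). set (q := fun t : R => h (t * z)%C).
  assert (Hp : forall t, 0 <= t <= 1 -> is_path_derive p t (z * q t)%C).
  { intros t Ht. apply (is_path_derive_comp f).
    - now apply Hf, unit_disc_ray.
    - apply is_path_derive_ray. }
  assert (Hq : forall t, 0 <= t <= 1 -> is_path_derive q t (z * - (A (t * z)%C * p t))%C).
  { intros t Ht. apply (is_path_derive_comp h).
    - now apply Hh, unit_disc_ray.
    - apply is_path_derive_ray. }
  assert (HE : Cmod (p 1) ^ 2 + Cmod (q 1) ^ 2 <= 0).
  { apply (gronwall_zero (fun t => Cmod (p t) ^ 2 + Cmod (q t) ^ 2)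
      (fun t => 2 * Re (Cconj (p t) * (z * q t))
              + 2 * Re (Cconj (q t) * (z * - (A (t * z)%C * p t)))) (1 + M)).
    - intros t Ht.
      apply (is_derive_plus (V := R_NormedModule) (fun t => Cmod (p t) ^ 2)
               (fun t => Cmod (q t) ^ 2)); apply is_derive_Cmod2; auto.
    - intros t Ht. specialize (HM t Ht).
      pose proof (Rle_trans _ _ _ (Rle_abs _) (re_le_Cmod (Cconj (p t) * (z * q t)))) as H1.
      pose proof (Rle_trans _ _ _ (Rle_abs _)
                    (re_le_Cmod (Cconj (q t) * (z * - (A (t * z)%C * p t))))) as H2.
      rewrite !Cmod_mult, Cmod_conj in H1.
      rewrite !Cmod_mult, Cmod_conj, Cmod_opp, Cmod_mult in H2.
      unfold unit_disc in Hz.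
      pose proof (Cmod_ge_0 z) as Hz0.
      pose proof (Cmod_ge_0 (p t)) as Hp0. pose proof (Cmod_ge_0 (q t)) as Hq0.
      pose proof (Cmod_ge_0 (A (t * z)%C)) as HA0.
      assert (H3 : Cmod (p t) * Cmod (q t) * Cmod z <= Cmod (p t) * Cmod (q t) * 1).
      { apply Rmult_le_compat_l; [nra|lra]. }
      assert (H4 : Cmod (p t) * Cmod (q t) * (Cmod z * Cmod (A (t * z)%C))
                   <= Cmod (p t) * Cmod (q t) * M).
      { apply Rmult_le_compat_l; nra. }
      assert (H5 : 2 * (Cmod (p t) * Cmod (q t)) <= Cmod (p t) ^ 2 + Cmod (q t) ^ 2).
      { pose proof (pow2_ge_0 (Cmod (p t) - Cmod (q t))). simpl in *. lra. }
      assert (H6 : 0 <= M) by lra.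
      apply Rle_trans with ((1 + M) * (2 * (Cmod (p t) * Cmod (q t)))); [lra|].
      apply Rmult_le_compat_l; lra.
    - unfold p, q. rewrite Cmult_0_l, Hf0, Hh0, Cmod_0. ring. }
  apply Cmod_eq_0. replace z with (1 * z)%C by ring. fold (p 1).
  pose proof (Cmod_ge_0 (p 1)). pose proof (pow2_ge_0 (Cmod (q 1))).
  pose proof (pow2_ge_0 (Cmod (p 1))). simpl in *. nra.
Qed.

Lemma analytic_C_derive (f : C -> C) (z : C) :
  analytic_disc f -> unit_disc z -> is_C_derive f z (C_derive f z).
Proof. intros Hf Hz. apply C_derive_correct; [exact z | now apply Hf]. Qed.

Lemma solution_second_derive (A f : C -> C) (z : C) :
  solution_disc A f -> unit_disc z ->
  is_C_derive (C_derive f) z (- (A z * f z))%C.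
Proof.
  intros [_ [H1 H2]] Hz.
  replace (- (A z * f z))%C with (C_derive (C_derive f) z).
  - now apply analytic_C_derive.
  - specialize (H2 z Hz). apply Ceq_minus. rewrite <- H2. ring.
Qed.

(** * The Wronskian *)

Definition wronskian (f g : C -> C) (z : C) : C :=
  (C_derive f z * g z - f z * C_derive g z)%C.

Lemma wronskian_const (A f g : C -> C) (z : C) :
  solution_disc A f -> solution_disc A g -> unit_disc z ->
  wronskian f g z = wronskian f g 0%C.
Proof.
  intros Hf Hg. apply zero_derive_const. clear z. intros z Hz.
  pose proof (analytic_C_derive f z (proj1 Hf) Hz) as Hf1.
  pose proof (analytic_C_derive g z (proj1 Hg) Hz) as Hg1.
  pose proof (is_C_derive_minus _ _ _ _ _
    (is_C_derive_mult _ _ _ _ _ (solution_second_derive A f z Hf Hz) Hg1)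
    (is_C_derive_mult _ _ _ _ _ Hf1 (solution_second_derive A g z Hg Hz))) as H.
  match type of H with is_derive _ _ ?d => replace (RtoC 0) with d by ring end.
  exact H.
Qed.

(** If the Wronskian vanishes at [0], then [g(0) f - f(0) g] has zero initial
    data, hence vanishes; its coefficients are not both zero. *)
Lemma wronskian_neq_0 (A f g : C -> C) :
  analytic_disc A -> solution_disc A f -> solution_disc A g ->
  lin_indep_disc f g -> (f 0%C <> 0%C \/ g 0%C <> 0%C) ->
  wronskian f g 0%C <> 0%C.
Proof.
  intros HA Hf Hg Hind Hne HW.
  destruct (Hind (g 0%C) (- f 0%C)%C) as [Ha Hb].
  - apply (ode_zero_unique A _
      (fun z => g 0%C * C_derive f z + - f 0%C * C_derive g z)%C HA).
    + intros z Hz. apply is_C_derive_plus; apply is_C_derive_scal;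
        apply analytic_C_derive; auto; [apply Hf | apply Hg].
    + intros z Hz.
      replace (- (A z * (g 0%C * f z + - f 0%C * g z)))%C
        with (g 0%C * - (A z * f z) + - f 0%C * - (A z * g z))%C by ring.
      apply is_C_derive_plus; apply is_C_derive_scal; now apply solution_second_derive.
    + ring.
    + etransitivity; [|exact HW]. unfold wronskian. ring.
  - destruct Hne as [H|H]; [|now apply H].
    apply H. replace (f 0%C) with (- - f 0%C)%C by ring. rewrite Hb. ring.
Qed.

(** * Bounds on the disc *)

Lemma sup_disc_lt_p_infty (F : C -> R) :
  Rbar_lt (sup_disc F) p_infty <-> exists M, forall z, unit_disc z -> F z <= M.
Proof.
  unfold sup_disc. set (E := fun y => exists z, unit_disc z /\ y = F z).
  destruct (Lub_Rbar_correct E) as [Hub Hleast]. split.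
  - intros Hlt.
    assert (H : forall z, unit_disc z -> Rbar_le (F z) (Lub_Rbar E)).
    { intros z Hz. apply Hub. now exists z. }
    destruct (Lub_Rbar E) as [M| |].
    + now exists M.
    + contradiction.
    + exists 0. intros z Hz. destruct (H z Hz).
  - intros [M HM].
    apply Rbar_le_lt_trans with (Finite M); [|exact I].
    apply Hleast. intros y [z [Hz ->]]. now apply HM.
Qed.

Lemma unit_disc_0 : unit_disc 0%C.
Proof. unfold unit_disc. rewrite Cmod_0. lra. Qed.

Lemma inf_disc_pos (F : C -> R) :
  Rbar_lt 0 (inf_disc F) -> exists d, 0 < d /\ forall z, unit_disc z -> d <= F z.
Proof.
  unfold inf_disc. set (E := fun y => exists z, unit_disc z /\ y = F z).
  destruct (Glb_Rbar_correct E) as [Hlb _].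
  intros Hlt.
  assert (H : forall z, unit_disc z -> Rbar_le (Glb_Rbar E) (F z)).
  { intros z Hz. apply Hlb. now exists z. }
  destruct (Glb_Rbar E) as [d| |].
  - now exists d.
  - destruct (H _ unit_disc_0).
  - contradiction.
Qed.

(** Cauchy's estimate for [f'] on the disc of radius [(1 - |z|) / 2] about [z],
    where [1 - |u|^2 >= 1 - |u| >= (1 - |z|) / 2]. *)
Lemma bloch_second_derivative (f : C -> C) :
  Bloch f -> analytic_disc (C_derive f) ->
  (forall z, unit_disc z -> continuous (C_derive (C_derive f)) z) ->
  exists M, forall z, unit_disc z ->
    Cmod (C_derive (C_derive f) z) * (1 - Cmod z ^ 2) ^ 2 <= M.
Proof.
  intros [_ HB] Hf' Hc.
  destruct (proj1 (sup_disc_lt_p_infty _) HB) as [M HM].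
  (* With [r] as below: [|f'| <= M / r] near [z], the radius [r / 2] loses a factor 2,
     and [1 - |z|^2 <= 2 (1 - |z|) = 4 r], which gives [2 * 4^2]. *)
  exists (32 * M). intros z Hz.
  pose proof (Cmod_ge_0 z) as Hz0. unfold unit_disc in Hz.
  set (r := (1 - Cmod z) / 2).
  assert (Hr : 0 < r) by (unfold r; lra).
  assert (Hin : forall u, Cmod (u - z) < r -> Cmod u <= 1 - r).
  { intros u Hu. replace u with (z + (u - z))%C by ring.
    eapply Rle_trans; [apply Cmod_triangle|]. unfold r in *; lra. }
  assert (HM0 : 0 <= M).
  { eapply Rle_trans; [|apply (HM _ unit_disc_0)].
    rewrite Cmod_0. pose proof (Cmod_ge_0 (C_derive f 0%C)). simpl in *; nra. }
  assert (Hest : r / 2 * Cmod (C_derive (C_derive f) z) <= M / r).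
  { apply (cauchy_estimate (C_derive f) (C_derive (C_derive f)) z r (M / r) (r / 2)).
    - intros u Hu. apply analytic_C_derive; [exact Hf'|].
      unfold unit_disc. specialize (Hin u Hu). lra.
    - intros u Hu. apply Hc. unfold unit_disc. specialize (Hin u Hu). lra.
    - intros u Hu. specialize (Hin u Hu). apply Rle_div_r; [lra|].
      eapply Rle_trans; [|apply (HM u); unfold unit_disc; lra].
      apply Rmult_le_compat_l; [apply Cmod_ge_0|].
      pose proof (Cmod_ge_0 u). simpl in *; nra.
    - lra. }
  apply Rle_div_r in Hest; [|exact Hr].
  pose proof (Cmod_ge_0 (C_derive (C_derive f) z)) as HD.
  set (D := Cmod (C_derive (C_derive f) z)) in *.
  apply Rle_trans with (D * (4 * r) ^ 2).
  - apply Rmult_le_compat_l; [exact HD|].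
    apply pow_incr. unfold r. simpl in *; nra.
  - simpl in *; lra.
Qed.

(** * The spherical derivative of a quotient *)

Lemma continuous_C_near (f : C -> C) (z : C) (eps : R) :
  continuous f z -> 0 < eps -> locally z (fun u => Cmod (f u - f z) < eps).
Proof.
  intros Hf Heps. apply (Hf (fun v => Cmod (v - f z) < eps)).
  apply locally_C. now exists (mkposreal _ Heps).
Qed.

Lemma locally_unit_disc (z : C) : unit_disc z -> locally z unit_disc.
Proof.
  unfold unit_disc. intros Hz.
  assert (H : 0 < 1 - Cmod z) by lra.
  apply locally_C. exists (mkposreal _ H). intros u Hu.
  change (Cmod (u - z) < 1 - Cmod z) in Hu.
  replace u with (z + (u - z))%C by ring.
  eapply Rle_lt_trans; [apply Cmod_triangle|]. lra.
Qed.

(** No point of [C] is isolated, so limits along punctured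
    neighbourhoods are unique. *)
Lemma locally'_C_proper (z : C) : ProperFilter' (locally' z).
Proof.
  split.
  - intros [d Hd]. pose proof (cond_pos d) as Hpos.
    apply (Hd (Re z + d / 2, Im z)).
    + split; simpl.
      * change (Rabs (Re z + d / 2 - Re z) < d). rewrite Rabs_pos_eq; lra.
      * apply ball_center.
    + intros H. apply (f_equal fst) in H. simpl in H. unfold Re in H. lra.
  - apply within_filter, locally_filter.
Qed.

Lemma simple_zero_isolated (f : C -> C) (z d : C) :
  is_C_derive f z d -> f z = 0%C -> d <> 0%C ->
  locally' z (fun u => f u <> 0%C).
Proof.
  intros Hf Hz Hd. rewrite is_C_derive_eps in Hf.
  assert (Hm : 0 < Cmod d) by now apply Cmod_gt_0.
  assert (He : 0 < Cmod d / 2) by lra.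
  destruct (Hf (mkposreal _ He)) as [del Hdel].
  apply locally_C. exists del. intros u Hu Hne Hfu.
  specialize (Hdel u Hu). cbn [pos] in Hdel.
  rewrite Hfu, Hz in Hdel.
  replace (0 - 0 - (u - z) * d)%C with (- ((u - z) * d))%C in Hdel by ring.
  rewrite Cmod_opp, Cmod_mult in Hdel.
  assert (0 < Cmod (u - z)).
  { apply Cmod_gt_0. intros H. apply Hne. now apply Ceq_minus. }
  nra.
Qed.

Lemma continuous_not_pole (w : C -> C) (z : C) : continuous w z -> ~ pole w z.
Proof.
  intros Hc Hp.
  assert (H1 : locally' z (fun u => Cmod (w z) + 1 < Cmod (w u))).
  { apply (Hp (fun x => Cmod (w z) + 1 < x)). now exists (Cmod (w z) + 1). }
  assert (H2 : locally' z (fun u => Cmod (w u - w z) < 1)).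
  { apply filter_le_within. apply (continuous_C_near w z 1 Hc). lra. }
  destruct (locally'_C_proper z) as [Hproper HF].
  apply Hproper. generalize (filter_and _ _ H1 H2). apply filter_imp.
  intros u [Ha Hb].
  pose proof (Cmod_triangle (w z) (w u - w z)) as Ht.
  replace (w z + (w u - w z))%C with (w u) in Ht by ring. lra.
Qed.

Lemma quotient_pole (f g : C -> C) (z : C) :
  continuous f z -> continuous g z -> f z <> 0%C -> g z = 0%C ->
  locally' z (fun u => g u <> 0%C) ->
  pole (fun u => f u / g u)%C z.
Proof.
  intros Hf Hg Hfz Hgz Hne P [M HM].
  assert (Hc : 0 < Cmod (f z)) by now apply Cmod_gt_0.
  pose proof (Rabs_pos M) as HM0.
  assert (H1 : locally' z (fun u => Cmod (f u - f z) < Cmod (f z) / 2)).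
  { apply filter_le_within. apply continuous_C_near; [exact Hf | lra]. }
  assert (Heps : 0 < Cmod (f z) / 2 / (Rabs M + 1)) by (apply Rdiv_lt_0_compat; lra).
  assert (H2 : locally' z (fun u => Cmod (g u - g z) < Cmod (f z) / 2 / (Rabs M + 1))).
  { apply filter_le_within. now apply continuous_C_near. }
  unfold filtermap.
  pose proof (filter_filter' (ProperFilter' := locally'_C_proper z)) as HF.
  generalize (filter_and _ _ Hne (filter_and _ _ H1 H2)). apply filter_imp.
  intros u [Hu [Ha Hb]]. apply HM.
  rewrite Hgz in Hb. replace (g u - 0)%C with (g u) in Hb by ring.
  apply Rlt_div_r in Hb; [|lra].
  assert (Hgu : 0 < Cmod (g u)) by now apply Cmod_gt_0.
  rewrite Cmod_div by exact Hu.
  apply Rlt_div_r; [exact Hgu|].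
  pose proof (Cmod_triangle_minus (f u) (f u - f z)) as Ht.
  replace (f u - (f u - f z))%C with (f z) in Ht by ring.
  pose proof (Rle_abs M). nra.
Qed.

(** Here [w' = W / g^2], and [|g|^2 (1 + |f / g|^2) = |f|^2 + |g|^2]. *)
Lemma spherical_quotient_wronskian (f g : C -> C) (z : C) :
  is_C_derive f z (C_derive f z) -> is_C_derive g z (C_derive g z) -> g z <> 0%C ->
  spherical_quotient (fun u => f u / g u)%C z
  = Cmod (wronskian f g z) / (Cmod (f z) ^ 2 + Cmod (g z) ^ 2).
Proof.
  intros Hf Hg Hz. unfold spherical_quotient.
  assert (Hw : C_derive (fun u => f u / g u)%C z = (wronskian f g z / (g z * g z))%C)
    by exact (is_C_derive_unique _ _ _ (is_C_derive_div f g z _ _ Hf Hg Hz)).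
  rewrite Hw.
  assert (Hm : 0 < Cmod (g z)) by now apply Cmod_gt_0.
  rewrite !Cmod_div, Cmod_mult by (auto using Cmult_neq_0).
  pose proof (pow2_ge_0 (Cmod (f z))) as H1.
  pose proof (pow_lt _ 2 Hm) as H2.
  field. simpl in *. repeat split; lra.
Qed.

Lemma continuous_Cmod2 (f : C -> C) (z : C) :
  continuous f z -> continuous (fun u => Cmod (f u) ^ 2) z.
Proof.
  intros Hf.
  apply (continuous_comp (V := C_UniformSpace) (W := R_UniformSpace) f (fun v => Cmod v ^ 2)).
  - exact Hf.
  - apply (continuous_comp (U := C_UniformSpace) (V := R_UniformSpace) (W := R_UniformSpace)
             Cmod (fun x => x ^ 2)).
    + exact (filterlim_norm (V := C_NormedModule) (f z)).
    + apply (ex_derive_continuous (V := R_NormedModule)). auto_derive. auto.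
Qed.

(** At a zero of [g] the constant [W] is [- f g'], which makes the zero simple:
    nearby the previous formula applies, and its right-hand side is continuous
    at the zero because [f] does not vanish there. *)
Lemma spherical_derivative_wronskian (f g : C -> C) (W : C) (z : C) :
  analytic_disc f -> analytic_disc g ->
  (forall u, unit_disc u -> wronskian f g u = W) -> W <> 0%C ->
  (forall u, unit_disc u -> 0 < Cmod (f u) + Cmod (g u)) ->
  unit_disc z ->
  spherical_derivative (fun u => f u / g u)%C z
  = Cmod W / (Cmod (f z) ^ 2 + Cmod (g z) ^ 2).
Proof.
  intros Hf Hg HW HW0 Hpos Hz.
  pose proof (analytic_C_derive f z Hf Hz) as Hfz.
  pose proof (analytic_C_derive g z Hg Hz) as Hgz.
  pose proof (is_C_derive_continuous _ _ _ Hfz) as Hfc.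
  pose proof (is_C_derive_continuous _ _ _ Hgz) as Hgc.
  unfold spherical_derivative.
  destruct (Ceq_dec (g z) 0) as [Hg0|Hg0].
  - assert (Hf0 : f z <> 0%C).
    { intros H. specialize (Hpos z Hz). rewrite H, Hg0, Cmod_0 in Hpos. lra. }
    assert (Hd : C_derive g z <> 0%C).
    { intros H. apply HW0. rewrite <- (HW z Hz). unfold wronskian.
      rewrite H, Hg0. ring. }
    pose proof (simple_zero_isolated g z _ Hgz Hg0 Hd) as Hiso.
    destruct (excluded_middle_informative _) as [_|Hnp].
    2: { destruct Hnp. now apply quotient_pole. }
    pose proof (locally'_C_proper z) as Hproper.
    pose proof (filter_filter' (ProperFilter' := Hproper)) as HF.
    apply (iota_filterlim_locally (V := R_CompleteNormedModule) (F := locally' z)).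
    apply filterlim_ext_loc
      with (f := fun u => Cmod W / (Cmod (f u) ^ 2 + Cmod (g u) ^ 2)).
    + assert (Hdisc : locally' z unit_disc) by now apply filter_le_within, locally_unit_disc.
      generalize (filter_and _ _ Hiso Hdisc). apply filter_imp. intros u [Hgu Hu].
      rewrite spherical_quotient_wronskian; [now rewrite HW | | |exact Hgu];
        now apply analytic_C_derive.
    + eapply filterlim_filter_le_1; [apply filter_le_within|].
      change (continuous (fun u => Cmod W / (Cmod (f u) ^ 2 + Cmod (g u) ^ 2)) z).
      apply (continuous_mult (K := R_AbsRing)); [apply continuous_const|].
      apply (continuous_comp (U := C_UniformSpace) (V := R_UniformSpace) (W := R_UniformSpace)
               (fun u => Cmod (f u) ^ 2 + Cmod (g u) ^ 2) Rinv).
      * apply (continuous_plus (V := R_NormedModule)); now apply continuous_Cmod2.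
      * apply continuous_Rinv. apply Cmod_gt_0 in Hf0. pose proof (pow_lt _ 2 Hf0).
        pose proof (pow2_ge_0 (Cmod (g z))). simpl in *; lra.
  - destruct (excluded_middle_informative _) as [Hp|_].
    + exfalso. revert Hp. apply continuous_not_pole.
      eapply is_C_derive_continuous. now apply is_C_derive_div; [exact Hfz|exact Hgz|].
    + rewrite spherical_quotient_wronskian by assumption. now rewrite HW.
Qed.

(** * Boundedness of the coefficient and of the spherical derivative *)

Theorem theorem7 (A f1 f2 : C -> C) :
  analytic_disc A ->
  Bloch f1 -> Bloch f2 ->
  solution_disc A f1 -> solution_disc A f2 ->
  lin_indep_disc f1 f2 ->
  Rbar_lt 0 (inf_disc (fun z => Cmod (f1 z) + Cmod (f2 z))) ->
  Rbar_lt (sup_disc (fun z => Cmod (A z) * (1 - Cmod z ^ 2) ^ 2)) p_infty /\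
  Rbar_lt (sup_disc (spherical_derivative (fun z => (f1 z / f2 z)%C))) p_infty.
Proof.
  intros HA HB1 HB2 Hs1 Hs2 Hind Hinf.
  destruct (inf_disc_pos _ Hinf) as [d [Hd Hlow]].
  split; apply sup_disc_lt_p_infty.
  - assert (Hsecond : forall f, Bloch f -> solution_disc A f -> exists M, forall z,
      unit_disc z -> Cmod (A z) * Cmod (f z) * (1 - Cmod z ^ 2) ^ 2 <= M).
    { intros f HB Hs.
      assert (Hc : forall z, unit_disc z -> continuous (C_derive (C_derive f)) z).
      { intros z Hz.
        destruct (HA z Hz) as [dA HdA].
        pose proof (analytic_C_derive f z (proj1 Hs) Hz) as Hf.
        (* The equation makes [f''] continuous: it is [- A f] on the disc. *)
        apply (continuous_ext_loc _ (fun u => - (1) * (A u * f u))%C).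
        - generalize (locally_unit_disc z Hz). apply filter_imp. intros u Hu.
          assert (Hopp : (- (1) * (A u * f u) = - (A u * f u))%C) by ring.
          rewrite Hopp. symmetry.
          exact (is_C_derive_unique _ _ _ (solution_second_derive A f u Hs Hu)).
        - eapply is_C_derive_continuous.
          apply is_C_derive_scal, is_C_derive_mult; [exact HdA | exact Hf]. }
      destruct (bloch_second_derivative f HB (proj1 (proj2 Hs)) Hc) as [M HM].
      exists M. intros z Hz. rewrite <- Cmod_mult, <- Cmod_opp.
      rewrite <- (is_C_derive_unique _ _ _ (solution_second_derive A f z Hs Hz)).
      now apply HM. }
    destruct (Hsecond f1 HB1 Hs1) as [M1 HM1].
    destruct (Hsecond f2 HB2 Hs2) as [M2 HM2].
    exists ((M1 + M2) / d). intros z Hz. apply (proj1 (Rle_div_r _ _ d Hd)).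
    specialize (HM1 z Hz). specialize (HM2 z Hz). specialize (Hlow z Hz).
    pose proof (Rmult_le_pos _ _ (Cmod_ge_0 (A z)) (pow2_ge_0 (1 - Cmod z ^ 2))) as Hp.
    pose proof (Rmult_le_compat_l _ _ _ Hp Hlow). lra.
  - assert (HW0 : wronskian f1 f2 0%C <> 0%C).
    { apply (wronskian_neq_0 A); auto.
      destruct (Ceq_dec (f1 0%C) 0) as [H1|H1]; [right|now left].
      intros H2. specialize (Hlow _ unit_disc_0). rewrite H1, H2, Cmod_0 in Hlow. lra. }
    exists (2 * Cmod (wronskian f1 f2 0%C) / d ^ 2). intros z Hz.
    rewrite (spherical_derivative_wronskian f1 f2 (wronskian f1 f2 0%C)); auto.
    + specialize (Hlow z Hz).
      pose proof (Cmod_ge_0 (f1 z)). pose proof (Cmod_ge_0 (f2 z)).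
      assert (Hd2 : 0 < d ^ 2) by now apply pow_lt.
      assert (Hsq : d ^ 2 <= 2 * (Cmod (f1 z) ^ 2 + Cmod (f2 z) ^ 2)).
      { apply Rle_trans with ((Cmod (f1 z) + Cmod (f2 z)) ^ 2).
        - apply pow_incr; lra.
        - pose proof (pow2_ge_0 (Cmod (f1 z) - Cmod (f2 z))). simpl in *; lra. }
      apply (proj1 (Rle_div_r _ _ _ Hd2)).
      unfold Rdiv. rewrite Rmult_assoc, (Rmult_comm 2).
      apply Rmult_le_compat_l; [apply Cmod_ge_0|].
      rewrite Rmult_comm. apply Rle_div_l; lra.
    + apply HB1.
    + apply HB2.
    + intros u Hu. now apply (wronskian_const A).
    + intros u Hu. specialize (Hlow u Hu). lra.
Qed.
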